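(* Let $X$ be a nonnegative random variable, let $\nu>0$, and let $\varphi:[0,\infty)\to[0,\infty)$ be a nondecreasing function with $\varphi(\nu)>0$. Then $$\Pr\{X>\nu\}\;\le\;\frac{E_{\nu}(\varphi(X))}{\varphi(\nu)}\;\le\;\frac{E(\varphi(X))}{\varphi(\nu)},$$ where $E_{\nu}(\varphi(X))=E\left(\varphi(X)\,1_{\{X>\nu\}}\right)$.
   Context: $X$ is a real-valued random variable on a probability space, with $X\ge 0$; no density is required. $E$ denotes expectation (the Lebesgue integral with respect to the probability measure, with values in $[0,\infty]$ for nonnegative random variables). $1_{\{X>\nu\}}$ is the indicator random variable of the event $\{X>\nu\}$, equal to $1$ when $X>\nu$ and $0$ when $X\le\nu$. The restricted expectation of $\varphi(X)$ is taken over the event $\{X>\nu\}$, that is, $E_{\nu}(\varphi(X))=E\left(\varphi(X)\,1_{\{X>\nu\}}\right)$. *)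

(* Defs.v *)
From mathcomp Require Export all_boot all_order all_algebra.
From mathcomp Require Export all_classical all_reals all_analysis.

(* Main.v *)
Require Import Defs.
From mathcomp Require Import measurable_realfun.
Import Order.TTheory GRing.Theory Num.Theory.
Import numFieldNormedType.Exports.
Local Open Scope classical_set_scope.
Local Open Scope ring_scope.
Local Open Scope ereal_scope.

(** Markov's inequality is a pointwise comparison, and the event can be kept
    inside the expectation.  Write [A] for the event [nu < X].  Since [phi] is
    nondecreasing and nonnegative on the values of [X],
    [phi nu * 1_A <= phi X * 1_A <= phi X] holds at every sample point.
    Integrating gives [phi nu * P A <= E (phi X * 1_A) <= E (phi X)], the first
    inequality being [ge_mul_probability_expectation_indic], and it remains to
    divide by the positive real [phi nu]; expectations equal to [+oo] are
    allowed throughout.  Monotonicity of the integral asks for measurable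
    integrands, and measurability follows from the monotonicity of [phi]
    ([measurable_nondecreasing_comp]). *)

(** Nothing is known of [phi] at negative reals, where it need not be
    measurable.  As [X] never takes such values, [phi] can be replaced by
    [x |-> phi (max x 0)], which is nondecreasing on the whole line and
    therefore Borel. *)
Lemma measurable_nondecreasing_comp (d : measure_display)
    (T : measurableType d) (R : realType) (X : T -> R) (phi : R -> R) :
  measurable_fun [set: T] X ->
  (forall w : T, (0 <= X w)%R) ->
  (forall x y : R, (0 <= x)%R -> (x <= y)%R -> (phi x <= phi y)%R) ->
  measurable_fun [set: T] (phi \o X).
Proof.
move=> mX X_ge0 phi_nd.
have -> : phi \o X = (fun x => phi (Num.max x 0%R)) \o X.
  by apply/funext => w /=; rewrite max_l.
apply: measurableT_comp => //; apply: nondecreasing_measurable => // x y xy.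
by apply: phi_nd; rewrite ?ge_max !le_max ?xy lexx !orbT.
Qed.

(** The integrands compare pointwise: [c * 1_A <= f * 1_A], both sides
    vanishing off [A]; the left-hand side of the lemma is the integral of
    [c * 1_A]. *)
Lemma ge_mul_probability_expectation_indic (d : measure_display)
    (T : measurableType d) (R : realType) (P : probability T R)
    (A : set T) (f : T -> R) (c : R) :
  measurable A -> measurable_fun [set: T] f -> (0 <= c)%R ->
  (forall w : T, A w -> (c <= f w)%R) ->
  c%:E * P A <= 'E_P[f \* \1_A].
Proof.
move=> mA mf c0 cf; rewrite unlock.
have -> : c%:E * P A = \int[P]_w (c%:E * (\1_A w)%:E).
  rewrite ge0_integralZl_EFin//; first by rewrite integral_indic// setIT.
  by apply/measurable_EFinP; exact: measurable_indic.
apply: ge0_le_integral => //.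
- by move=> w _; rewrite -EFinM lee_fin mulr_ge0.
- by apply/measurable_EFinP; apply: measurable_funM => //;
    exact: measurable_indic.
- by apply/measurable_EFinP; apply: measurable_funM => //;
    exact: measurable_indic.
move=> w _; rewrite -EFinM lee_fin /= indicE.
by have [/set_mem /cf|_] := boolP (w \in A); rewrite ?mulr1 ?mulr0.
Qed.

Theorem corollary2 (d : measure_display) (T : measurableType d) (R : realType)
    (P : probability T R) (X : {RV P >-> R}) (nu : R) (phi : R -> R)
    (X_ge0 : forall w : T, (0 <= X w)%R)
    (nu_gt0 : (0 < nu)%R)
    (phi_ge0 : forall x : R, (0 <= x)%R -> (0 <= phi x)%R)
    (phi_nd : forall x y : R, (0 <= x)%R -> (x <= y)%R -> (phi x <= phi y)%R)
    (phi_nu_gt0 : (0 < phi nu)%R) :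
  P [set w | (nu < X w)%R]
    <= 'E_P[(phi \o X) \* \1_[set w | (nu < X w)%R]] / (phi nu)%:E
    <= 'E_P[phi \o X] / (phi nu)%:E.
Proof.
set A := [set w | _].
have mA : measurable A.
  have -> : A = X @^-1` `]nu, +oo[.
    by apply/seteqP; split => w /=; rewrite /A /= in_itv/= andbT.
  by rewrite -[_ @^-1` _]setTI; exact: measurable_funP.
have mphiX : measurable_fun [set: T] (phi \o X).
  exact: measurable_nondecreasing_comp.
rewrite inver (gt_eqF phi_nu_gt0); apply/andP; split.
  rewrite lee_pdivlMr// muleC; apply: ge_mul_probability_expectation_indic => //.
    exact: ltW.
  by move=> w /ltW; apply: phi_nd; exact: ltW.
apply: lee_wpmul2r; first by rewrite lee_fin invr_ge0 ltW.
apply: expectation_le => //.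
- by apply: measurable_funM => //; exact: measurable_indic.
- by move=> w /=; rewrite mulr_ge0// phi_ge0.
- by move=> w /=; exact: phi_ge0.
by apply: aeW => w /=; rewrite ler_piMr ?phi_ge0// indicE lern1 leq_b1.
Qed.
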